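(* A graph $X$ is Laplacian periodic at a vertex $a$ (at some time $\tau>0$) if and only if $\Phi_a$ contains only integers. Moreover, if $X$ is Laplacian periodic at $a$ at time $\tau$, then $\tau$ is an integer multiple of $2\pi/G$, where $G=\gcd\Phi_a$.
   Context: Let $L=D-A$ be the Laplacian of $X$ with spectral decomposition $L=\sum_r\mu_rF_r$ ($\mu_r$ the distinct eigenvalues, $F_r$ the orthogonal projection onto the $\mu_r$-eigenspace), and $U(t)=\exp(itL)$. $X$ is Laplacian periodic at $a$ at time $\tau$ if $U(\tau)e_a=\alpha e_a$ for some complex $\alpha$. The eigenvalue support of $a$ is $\Phi_a=\{\mu_r: F_re_a\neq 0\}$. *)

(* Defs.v *)
From mathcomp Require Import all_boot all_order all_algebra spectral.
From mathcomp Require Import complex.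
From mathcomp Require Import all_classical all_reals all_analysis.

Set Implicit Arguments.
Unset Strict Implicit.
Unset Printing Implicit Defensive.

Import Order.TTheory GRing.Theory Num.Theory.
Import numFieldNormedType.Exports.

Local Open Scope classical_set_scope.
Local Open Scope ring_scope.

(* Vectors are row vectors and matrices act on them from the right, so that   *)
(* [eigenspace] and [proj_ortho] apply as they stand.  The Laplacian is       *)
(* symmetric, so this agrees with the convention of columns and left actions. *)

(* The regular module [R[i]^o] carries the topology given by the modulus;     *)
(* on matrices the limit below is the entrywise one.                          *)
Definition expmx (R : realType) (n : nat) (A : 'M[R[i]]_n) : 'M[R[i]]_n :=
  limn (series (fun k => (k`!%:R^-1 *: A ^+ k : 'M[R[i]^o]_n))).

Section Laplacian.
Variables (R : realType) (n : nat) (adj : rel 'I_n).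

Definition adjacency : 'M[R[i]]_n := \matrix_(i, j) (adj i j)%:R.

Definition degree_mx : 'M[R[i]]_n := diag_mx (\row_i (#|[set j | adj i j]%SET|)%:R).

Definition laplacian : 'M[R[i]]_n := degree_mx - adjacency.

Definition walk (t : R) : 'M[R[i]]_n := expmx ((0 +i* t)%C *: laplacian).

Definition unit_vec (a : 'I_n) : 'rV[R[i]]_n := delta_mx 0 a.

Definition eigenprojection (mu : R[i]) : 'M[R[i]]_n :=
  proj_ortho (eigenspace laplacian mu).

Definition periodic_at (a : 'I_n) (tau : R) : Prop :=
  exists alpha : R[i], unit_vec a *m walk tau = alpha *: unit_vec a.

Definition eigenvalue_support (a : 'I_n) : set R[i] :=
  [set mu | eigenvalue laplacian mu /\ unit_vec a *m eigenprojection mu != 0].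

(* The gcd of the integers in the (finite) eigenvalue support; it is 0 if     *)
(* the support is {0}, i.e. if [a] is an isolated vertex.                     *)
Definition support_gcd (a : 'I_n) : nat :=
  \big[gcdn/0%N]_(z \in [set z : int | eigenvalue_support a z%:~R]) `|z|%N.

End Laplacian.

(* Main.v *)
(* Write e_a = v P in an orthonormal eigenbasis P of the Laplacian; the       *)
(* eigenvalue support is the set of the d_j with v_j != 0.  Then U(tau) fixes *)
(* e_a up to a scalar alpha iff exp(i tau mu) = alpha for all mu in the       *)
(* support; since 0 is in the support (the all-ones vector is not orthogonal  *)
(* to e_a), alpha = 1 and tau mu is in 2 pi Z for all mu in the support.      *)
(* The gcd statement is then Bezout.  For integrality, every mu is a natural  *)
(* multiple of theta = 2 pi / tau, as mu >= 0.  The sum of the support is a   *)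
(* coefficient of the minimal polynomial of the rational vector e_a, hence it *)
(* is rational; it is also a positive multiple of theta as soon as the        *)
(* support is not {0}.  So theta is rational, and a rational eigenvalue of an *)
(* integer matrix is an integer.                                              *)

Require Import Defs.
From mathcomp Require Import all_boot all_order all_algebra all_field spectral.
From mathcomp Require Import complex.
From mathcomp Require Import all_classical all_reals all_analysis.
From mathcomp Require Import ring lra.

Set Implicit Arguments.
Unset Strict Implicit.
Unset Printing Implicit Defensive.

Import Order.TTheory GRing.Theory Num.Theory.
Import numFieldNormedType.Exports.

Local Open Scope classical_set_scope.
Local Open Scope ring_scope.

(** In coordinates with respect to [spectralmx], the walk multiplies the j-th entry of e_a by a
    phase ([walk_eigencoord]), so periodicity becomes the arithmetic condition tau * mu in 2 pi Z on
    the support ([periodic_atP]). Taking tau = 2 pi settles integral supports, and closing the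
    condition under integer combinations gives the gcd claim ([periodic_at_support_gcd]).
    Conversely, the support is nonnegative ([eigenvalue_support_ge0]), so its sum, a sum of
    multiples of 2 pi / tau, cannot cancel; this sum is rational ([sum_cyclic_support]), which makes
    each eigenvalue in the support rational ([periodic_at_rational]), and [rat_eigenvalue_int]
    passes from rational to integral. *)

(** * The exponential of a diagonalizable matrix *)

Lemma cvg_real_complex (R : realType) (u : R^nat) (x : R) :
  u @ \oo --> x -> (fun k => (u k)%:C%C : R[i]^o) @ \oo --> (x%:C%C : R[i]^o).
Proof.
move=> ux; apply/cvgrPdist_lt => -[e e'] /=.
rewrite ltcE /= => /andP[/eqP -> e0].
move/cvgrPdist_lt: ux => /(_ e e0); apply: filterS => k /=.
rewrite -rmorphB normc_def /= expr0n /= addr0 sqrtr_sqr => h.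
by rewrite ltcE /= eqxx.
Qed.

(** Euler's formula: the even and odd terms of the series are those of cosine and of i times
    sine. *)
Lemma cvg_expi (R : realType) (x : R) :
  series (fun k => k`!%:R^-1 *: (0 +i* x)%C ^+ k : R[i]^o) @ \oo -->
  ((cos x +i* sin x)%C : R[i]^o).
Proof.
have sumE N : series (fun k => k`!%:R^-1 *: (0 +i* x)%C ^+ k : R[i]^o) N =
    (series (cos_coeff x) N)%:C%C +
    (series (sin_coeff x) N)%:C%C *: ('i%C : R[i]^o).
  rewrite /series /= !rmorph_sum scaler_suml -big_split /=.
  apply: eq_bigr => k _.
  rewrite /cos_coeff /sin_coeff /=.
  have -> : (0 +i* x)%C = 'i%C * x%:C%C by simpc.
  have kk : (k`!%:R^-1 : R[i]) = (k`!%:R^-1)%:C%C by rewrite fmorphV rmorph_nat.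
  have ik : 'i%C ^+ k = ('i%C ^+ odd k * ((-1) ^+ k./2)%:C%C) :> R[i].
    rewrite -{1}(odd_double_half k) exprD -mul2n exprM sqr_i.
    by rewrite rmorphXn rmorphN1.
  (* The sign in [sin_coeff] has exponent [k.-1./2], while the power of i yields [k./2]. *)
  have pk : odd k -> (k.-1)./2 = k./2.
    by case: k {kk ik} => //= k; rewrite uphalf_half => /negbTE ->.
  rewrite /GRing.scale /= exprMn kk ik -rmorphXn.
  by move: pk; case: (odd k) => [/(_ isT) -> | _] /=; simpc;
    congr (_ +i* _)%C; ring.
under eq_cvg do rewrite sumE.
have -> : (cos x +i* sin x)%C = (cos x)%:C%C + (sin x)%:C%C *: ('i%C : R[i]^o).
  by rewrite /GRing.scale /=; simpc.
apply: cvgD; last apply: cvgZl; apply: cvg_real_complex; rewrite unlock.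
  exact: is_cvg_series_cos_coeff.
exact: is_cvg_series_sin_coeff.
Qed.

Lemma exp_conj_diag_mx (F : fieldType) n (P : 'M[F]_n) (d : 'rV[F]_n) k :
  P \in unitmx ->
  (invmx P *m diag_mx d *m P) ^+ k =
  invmx P *m diag_mx (\row_j d 0 j ^+ k) *m P.
Proof.
move=> Pu; elim: k => [|k IH].
  rewrite expr0 (_ : \row_j _ = const_mx 1).
    by rewrite diag_const_mx mulmx1 mulVmx.
  by apply/rowP => j; rewrite !mxE.
rewrite exprS IH -[LHS]/(_ *m _) !mulmxA mulmxK //.
rewrite -(mulmxA (invmx P)) mulmx_diag.
by congr (_ *m diag_mx _ *m _); apply/rowP => j; rewrite !mxE exprS.
Qed.

(** Every partial sum is a combination of the fixed idempotents [E j], so convergence reduces to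
    that of the scalar coefficients. *)
Lemma expmx_diag (R : realType) n (A P : 'M[R[i]]_n) (d e : 'rV[R[i]]_n) :
  P \in unitmx -> A = invmx P *m diag_mx d *m P ->
  (forall j, series (fun k => k`!%:R^-1 *: d 0 j ^+ k : R[i]^o) @ \oo -->
     (e 0 j : R[i]^o)) ->
  expmx A = invmx P *m diag_mx e *m P.
Proof.
move=> Pu AE de.
pose E j : 'M[R[i]]_n := invmx P *m delta_mx j j *m P.
have diagE (f : 'rV[R[i]]_n) : invmx P *m diag_mx f *m P = \sum_j f 0 j *: E j.
  rewrite diag_mx_sum_delta mulmx_sumr mulmx_suml; apply: eq_bigr => j _.
  by rewrite -scalemxAr -scalemxAl.
have powE k : A ^+ k = \sum_j d 0 j ^+ k *: E j.
  rewrite AE exp_conj_diag_mx // diagE.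
  by apply: eq_bigr => j _; rewrite mxE.
pose u := fun k => (k`!%:R^-1 *: A ^+ k : 'M[R[i]^o]_n).
pose s j := series (fun k => k`!%:R^-1 *: d 0 j ^+ k : R[i]^o).
have sumE : series u = fun N => \sum_j s j N *: (E j : 'M[R[i]^o]_n).
  apply/funext => N; rewrite /series /=.
  under eq_bigr do rewrite /u powE scaler_sumr.
  rewrite exchange_big /=; apply: eq_bigr => j _.
  by rewrite /s scaler_suml; apply: eq_bigr => k _; rewrite scalerA.
have cvgu : series u @ \oo --> (\sum_j e 0 j *: E j : 'M[R[i]^o]_n).
  rewrite sumE; apply: cvg_big => [|j _]; first exact: add_continuous.
  by apply: cvgZl; exact: de.
rewrite diagE; apply: (@cvg_lim 'M[R[i]^o]_n).
  exact: norm_hausdorff.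
exact: cvgu.
Qed.

(** * Eigenprojections in an orthonormal eigenbasis *)

Section SpectralCoordinates.
Local Open Scope sesquilinear_scope.
Variables (C : numClosedFieldType) (n : nat) (A : 'M[C]_n).
Hypothesis A_normal : A \is normalmx.
Let P := spectralmx A.
Let d := spectral_diag A.

Lemma row_spectralmx_eigen j : row j P *m A = d 0 j *: row j P.
Proof.
have Pu : P \in unitmx := spectral_unit A.
rewrite {1}(orthomx_spectralP A_normal) -/P -/d -!row_mul !mulmxA.
rewrite mulmxV // mul1mx.
by apply/rowP => k; rewrite mul_diag_mx !mxE.
Qed.

Lemma row_spectralmx_neq0 j : row j P != 0.
Proof.
apply/eqP => Pj0; have : row j P *m invmx P = 0 by rewrite Pj0 mul0mx.
rewrite -row_mul mulmxV ?spectral_unit // => /rowP /(_ j) /eqP.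
by rewrite !mxE eqxx oner_eq0.
Qed.

Lemma spectral_coord_eigen m (X : 'M[C]_(m, n)) mu r j :
  X *m A = mu *: X -> (X *m invmx P) r j != 0 -> d 0 j = mu.
Proof.
have Pu : P \in unitmx := spectral_unit A.
rewrite {1}(orthomx_spectralP A_normal) -/P -/d.
move=> /(congr1 (mulmx^~ (invmx P))).
rewrite !mulmxA mulmxK // -scalemxAl => /matrixP /(_ r j).
rewrite mul_mx_diag !mxE => + nz; rewrite mulrC; exact: mulIf.
Qed.

(** A vector with zero projection is orthogonal to the whole eigenspace. Applied below to rows of
    the eigenbasis and to the all-ones vector. *)
Lemma proj_ortho_eigenspace_neq0_eigen (u x : 'rV[C]_n) mu :
  x *m A = mu *: x -> u *m x^t* != 0 ->
  u *m proj_ortho (eigenspace A mu) != 0.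
Proof.
move=> xA; apply: contra => /eqP pr0.
have := proj_ortho_compl_sub (eigenspace A mu) u; rewrite pr0 subr0 => uV.
have xV : (x <= eigenspace A mu)%MS by apply/eigenspaceP.
by rewrite -orthomx1E (submx_trans uV) // submx_ortho.
Qed.

Lemma proj_ortho_eigenspace_neq0 (u : 'rV[C]_n) mu :
  u *m proj_ortho (eigenspace A mu) != 0 <->
  exists j, d 0 j = mu /\ (u *m invmx P) 0 j != 0.
Proof.
have PU : P \is unitarymx := spectral_unitarymx A.
have Pu : P \in unitmx := spectral_unit A.
split=> [|[j [dj nz]]].
  apply: contraPP => none; apply/negP; rewrite negbK.
  apply/eqP/proj_ortho_0/orthomx1P.
  set V := eigenspace A mu.
  have VA : V *m A = mu *: V by apply/eigenspaceP.
  (* [P] is unitary, so inner products may be computed in coordinates; each term then has a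
     vanishing factor. *)
  rewrite -[u](mulmxKV Pu) -[V](mulmxKV Pu) trmx_mul map_mxM !mulmxA.
  rewrite (mulmxtVK _ PU); apply/rowP => r.
  rewrite mxE big1 => [|j _]; first by rewrite mxE.
  have -> : ((V *m invmx P) ^t*) j r = ((V *m invmx P) r j)^*.
    by rewrite mxE [X in X^*]mxE.
  have [-> | nz] := eqVneq ((u *m invmx P) 0 j) 0; first by rewrite mul0r.
  have [-> | nz'] := eqVneq ((V *m invmx P) r j) 0.
    by rewrite rmorph0 mulr0.
  by case: none; exists j; split => //; exact: spectral_coord_eigen VA nz'.
apply: (@proj_ortho_eigenspace_neq0_eigen _ (row j P)).
  by rewrite row_spectralmx_eigen dj.
apply: contra nz => /eqP/matrixP /(_ 0 0).
rewrite invmx_unitary // [X in _ = X -> _]mxE => uP0.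
by apply/eqP; rewrite -[RHS]uP0 !mxE; apply: eq_bigr => k _; rewrite !mxE.
Qed.

End SpectralCoordinates.

(** * Nonnegativity of the Laplacian spectrum *)

Section LaplacianSpectrum.
Local Open Scope sesquilinear_scope.
Variables (R : realType) (n : nat) (adj : rel 'I_n).
Hypothesis adj_sym : symmetric adj.
Let L := laplacian R adj.
Let P := spectralmx L.
Let d := spectral_diag L.

Lemma laplacian_mulE (x : 'rV[R[i]]_n) j :
  (x *m L) 0 j = \sum_i (adj i j)%:R * (x 0 j - x 0 i).
Proof.
rewrite /L /laplacian mulmxBr /degree_mx mul_mx_diag !mxE.
rewrite -sum1_card natr_sum mulr_sumr big_mkcond /= -sumrB.
apply: eq_bigr => i _; rewrite !mxE inE (adj_sym j i).
by case: (adj i j); rewrite /= ?mulr1 ?mulr0 ?mul1r ?mul0r ?subr0.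
Qed.

Lemma laplacian_normal : L \is normalmx.
Proof.
apply/hermitian_normalmx/is_hermitianmxP; rewrite expr0 scale1r.
apply/matrixP => i j; rewrite !mxE rmorphB /= !rmorphMn /= !rmorph1.
rewrite (adj_sym i j) (eq_sym i j).
by congr (_ - _); case: eqP => [->|].
Qed.

Lemma laplacian_eigenvalue_ge0 (x : 'rV[R[i]]_n) mu :
  x *m L = mu *: x -> x != 0 -> 0 <= mu.
Proof.
move=> xL x0.
(* [S] is the quadratic form x L x^*. Adding to it its copy with [i] and [j] exchanged gives a sum
   of squares. *)
pose S := \sum_j \sum_i (adj i j)%:R * (x 0 j - x 0 i) * (x 0 j)^*.
have S1 : S = mu * \sum_j `|x 0 j| ^+ 2.
  rewrite mulr_sumr; apply: eq_bigr => j _.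
  by rewrite -mulr_suml -laplacian_mulE xL mxE -mulrA normCK.
have S2 : S + S = \sum_j \sum_i (adj i j)%:R * `|x 0 j - x 0 i| ^+ 2.
  rewrite {2}/S exchange_big /= -big_split; apply: eq_bigr => j _.
  rewrite -big_split; apply: eq_bigr => i _.
  by rewrite /= normCK rmorphB (adj_sym j i); ring.
have Sge : 0 <= S + S.
  rewrite S2; apply: sumr_ge0 => j _; apply: sumr_ge0 => i _.
  by rewrite mulr_ge0 ?ler0n // exprn_ge0.
have Npos : 0 < \sum_j `|x 0 j| ^+ 2.
  rewrite lt_def sumr_ge0 ?andbT => [|j _]; last exact: exprn_ge0.
  apply: contra x0 => /eqP/psumr_eq0P h; apply/eqP/rowP => j.
  have /eqP := h (fun j _ => exprn_ge0 2 (normr_ge0 (x 0 j))) j isT.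
  by rewrite expf_eq0 /= normr_eq0 mxE => /eqP.
by move: Sge; rewrite -mulr2n pmulrn_lge0 // S1 pmulr_lge0.
Qed.

End LaplacianSpectrum.

(** * Periodicity as a condition on phases *)

(** Reduce [x] modulo 2 pi to [y] in [0, 2 pi). The half-angle formula gives sin (y / 2) = 0, and
    sine is positive on the open interval (0, pi), so [y] is 0. *)
Lemma cos_eq1 (R : realType) (x : R) :
  cos x = 1 <-> exists k : int, x = k%:~R * (2 * pi).
Proof.
have cosDz (k : int) (y : R) : cos (y + k%:~R * (2 * pi)) = cos y.
  have cosDn (m : nat) z : cos (z + m%:R * (2 * pi)) = cos z :> R.
    rewrite !mulr_natl; exact/periodicn/cosD2pi.
  case: (intP k) => [|m|m]; first by rewrite mul0r addr0.
    exact: (cosDn m.+1).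
  by rewrite -[LHS](cosDn m.+1) mulrNz mulNr -pmulrn subrK.
split=> [cx|[k ->]]; last by rewrite -[_ * _]add0r cosDz cos0.
have pi2 : 0 < 2 * pi :> R by rewrite mulr_gt0 ?pi_gt0.
pose k := Num.floor (x / (2 * pi)); exists k.
pose y := x - k%:~R * (2 * pi).
have xE : x = y + k%:~R * (2 * pi) by rewrite subrK.
have cy : cos y = 1 by rewrite -[RHS]cx [in RHS]xE cosDz.
have y_ge0 : 0 <= y by rewrite subr_ge0 -ler_pdivlMr // floor_le_tmp.
have y_lt : y < 2 * pi.
  rewrite ltrBlDr -[X in X + _]mul1r -mulrDl -ltr_pdivrMr //.
  by rewrite addrC -intrD1 floorD1_gt.
have hE : y = y / 2 + y / 2 by rewrite -splitr.
have /eqP : sin (y / 2) = 0.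
  have := cy; rewrite {1}hE cosD -!expr2 cos2sin2 => h.
  have /eqP : sin (y / 2) ^+ 2 = 0 by lra.
  by rewrite expf_eq0 /= => /eqP.
have [y_gt0 | y_le0] := ltP 0 y; last first.
  by move=> _; rewrite xE (le_anti (introT andP (conj y_le0 y_ge0))) add0r.
rewrite gt_eqF // sin_gt0_pi // divr_gt0 //= ltr_pdivrMr // mulrC; exact: y_lt.
Qed.

Section Periodicity.
Variables (R : realType) (n : nat) (adj : rel 'I_n).
Hypothesis adj_sym : symmetric adj.
Let L := laplacian R adj.
Let P := spectralmx L.
Let d := spectral_diag L.
Variable a : 'I_n.
Let v : 'rV[R[i]]_n := unit_vec R a *m invmx P.

Lemma eigenvalue_supportP mu :
  eigenvalue_support adj a mu <-> exists j, d 0 j = mu /\ v 0 j != 0.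
Proof.
have L_normal : L \is normalmx := laplacian_normal R adj_sym.
split=> [[_] /(proj_ortho_eigenspace_neq0 L_normal)// | vj].
split; last exact/(proj_ortho_eigenspace_neq0 L_normal).
have [j [<- nz]] := vj; apply/eigenvalueP; exists (row j P).
  exact: row_spectralmx_eigen.
exact: row_spectralmx_neq0.
Qed.

Lemma eigenvalue_support_ge0 (mu : R[i]) :
  eigenvalue_support adj a mu -> 0 <= mu.
Proof.
by case=> /eigenvalueP[x xL x0] _; exact: laplacian_eigenvalue_ge0 xL x0.
Qed.

Lemma eigenvalue_support0 : eigenvalue_support adj a (0 : R[i]).
Proof.
have oneL : const_mx 1 *m L = 0 *: (const_mx 1 : 'rV[R[i]]_n).
  apply/rowP => j; rewrite laplacian_mulE // !mxE mul0r big1 // => i _.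
  by rewrite !mxE subrr mulr0.
split.
  apply/eigenvalueP; exists (const_mx 1) => //.
  by apply/eqP => /rowP /(_ a) /eqP; rewrite !mxE oner_eq0.
apply: proj_ortho_eigenspace_neq0_eigen oneL _.
apply/eqP => /matrixP /(_ 0 0) /eqP; rewrite /unit_vec -rowE !mxE rmorph1.
by rewrite oner_eq0.
Qed.

Let phases (tau : R) : 'rV[R[i]]_n := \row_j
  (cos (tau * complex.Re (d 0 j)) +i* sin (tau * complex.Re (d 0 j)))%C.

Lemma walk_eigencoord (tau : R) :
  walk adj tau = invmx P *m diag_mx (phases tau) *m P.
Proof.
have L_normal : L \is normalmx := laplacian_normal R adj_sym.
have Pu : P \in unitmx := spectral_unit L.
apply: (expmx_diag Pu (d := (0 +i* tau)%C *: d)) => [|j].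
  rewrite [diag_mx _]linearZ -/L {1}(orthomx_spectralP L_normal) -/P -/d.
  by rewrite -scalemxAr -scalemxAl.
rewrite !mxE.
(* Eigenvalues are real, so the exponent is purely imaginary and [cvg_expi] applies. *)
have d_ge0 : 0 <= d 0 j.
  apply: (laplacian_eigenvalue_ge0 adj_sym (row_spectralmx_eigen _ _)) => //.
  exact: row_spectralmx_neq0.
have -> : (0 +i* tau)%C * d 0 j = (0 +i* (tau * complex.Re (d 0 j)))%C.
  move: d_ge0; case: (d 0 j) => x y; rewrite lecE /= => /andP[/eqP -> _].
  by simpc.
exact: cvg_expi.
Qed.

Lemma periodic_atP (tau : R) :
  periodic_at adj a tau <->
  forall mu : R[i], eigenvalue_support adj a mu ->
    exists k : int, tau * complex.Re mu = k%:~R * (2 * pi).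
Proof.
have Pu : P \in unitmx := spectral_unit L.
pose e := phases tau.
have walkE : unit_vec R a *m walk adj tau = v *m diag_mx e *m P.
  by rewrite walk_eigencoord !mulmxA.
split=> [[alpha] | tau_int].
  rewrite walkE => /(congr1 (mulmx^~ (invmx P))).
  rewrite mulmxK // -scalemxAl -/v => ve.
  have eE j : v 0 j != 0 -> e 0 j = alpha.
    move=> nz; apply: (mulIf nz); rewrite mulrC.
    by move/rowP/(_ j): ve; rewrite mul_mx_diag mxE [X in _ = X -> _]mxE.
  (* The eigenvalue 0 lies in the support and its phase is 1. *)
  have alpha1 : alpha = 1.
    have /eigenvalue_supportP[j [dj /eE <-]] := eigenvalue_support0.
    by rewrite mxE dj mulr0 cos0 sin0.
  move=> mu /eigenvalue_supportP[j [<- /eE]]; rewrite mxE alpha1 => -[cos1 _].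
  exact/cos_eq1.
exists 1; rewrite scale1r walkE -[RHS](mulmxKV Pu) -/v; congr (_ *m _).
apply/rowP => j; rewrite mul_mx_diag [LHS]mxE.
have [-> | nz] := eqVneq (v 0 j) 0; first by rewrite mul0r.
have /cos_eq1 c1 : exists k : int, tau * complex.Re (d 0 j) = k%:~R * (2 * pi).
  by apply: tau_int; apply/eigenvalue_supportP; exists j.
have s0 : sin (tau * complex.Re (d 0 j)) = 0.
  by apply/eqP; rewrite -norm_cos_eq1 c1 normr1.
by rewrite [e 0 j]mxE c1 s0 mulr1.
Qed.

End Periodicity.

(** * Rationality of the sum of the support *)

Section RationalCyclicVector.
Variables (aF rF : fieldType) (f : {rmorphism aF -> rF}).

Lemma map_mx_expr n (B : 'M[aF]_n) k : map_mx f (B ^+ k) = map_mx f B ^+ k.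
Proof.
elim: k => [|k IH]; first by rewrite !expr0; exact: map_mx1.
by rewrite !exprS -IH; exact: map_mxM.
Qed.

(** A linear system over [aF] that is solvable over [rF] is solvable over [aF]; independence of the
    rows makes the two solutions agree. *)
Lemma submx_map_coef m n (K : 'M[aF]_(m, n)) (w : 'rV[aF]_n) (c : 'rV[rF]_m) :
  row_free K -> c *m map_mx f K = map_mx f w -> exists c', c = map_mx f c'.
Proof.
move=> Kfree cK.
have /submxP[c' wE] : (w <= K)%MS by rewrite -(map_submx f) -cK submxMl.
exists c'; apply: (row_free_inj (A := map_mx f K)).
  by rewrite row_free_map.
by rewrite /= cK wE map_mxM.
Qed.

Variables (n : nat) (B : 'M[aF]_n) (u : 'rV[aF]_n).
Variables (P : 'M[rF]_n) (d : 'rV[rF]_n).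
Hypotheses (Pu : P \in unitmx) (BE : map_mx f B = invmx P *m diag_mx d *m P).
Let v := map_mx f u *m invmx P.

(** Computes u p(B) in the eigenbasis: [B] acts diagonally there, so p(B) scales coordinate [j] by
    [p.[d 0 j]]. *)
Lemma mulmx_horner_coord m (p : {poly rF}) : (size p <= m)%N ->
  \sum_(k < m) p`_k *: (map_mx f u *m map_mx f B ^+ k) =
  (\row_j (v 0 j * p.[d 0 j])) *m P.
Proof.
move=> sp.
transitivity (\sum_(k < m) p`_k *: (\row_j (v 0 j * d 0 j ^+ k) *m P)).
  apply: eq_bigr => k _; rewrite BE exp_conj_diag_mx // !mulmxA -/v.
  congr (_ *: (_ *m _)); apply/rowP => j.
  by rewrite mul_mx_diag mxE [in RHS]mxE; congr (_ * _); rewrite mxE.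
under eq_bigr do rewrite scalemxAl; rewrite -mulmx_suml; congr (_ *m _).
apply/rowP => j; rewrite summxE [RHS]mxE (horner_coef_wide _ sp) mulr_sumr.
by apply: eq_bigr => k _; rewrite mxE [X in _ * X]mxE mulrCA.
Qed.

(* The vectors [u B^k], for [k < size S], form a basis of the cyclic module   *)
(* generated by [u], both over [aF] and over [rF]; so the coefficients of the *)
(* minimal polynomial of [u], whose roots are [S], lie in [aF].               *)
Lemma sum_cyclic_support (S : seq rF) : uniq S ->
  (forall z, z \in S <-> exists j, d 0 j = z /\ v 0 j != 0) ->
  exists q, \sum_(z <- S) z = f q.
Proof.
move=> uS memS.
have [S0 | S_neq0] := eqVneq (size S) 0%N.
  by exists 0; rewrite (size0nil S0) big_nil rmorph0.
pose s := size S.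
pose K := \matrix_(k < s) (u *m B ^+ k).
have mapK (c : 'rV[rF]_s) :
    c *m map_mx f K = \sum_(k < s) c 0 k *: (map_mx f u *m map_mx f B ^+ k).
  rewrite mulmx_sum_row; apply: eq_bigr => k _.
  by rewrite -map_row rowK map_mxM map_mx_expr.
have Kfree : row_free K.
  rewrite -(row_free_map f); apply: inj_row_free => c.
  rewrite mapK; under eq_bigr do rewrite -coef_rVpoly_ord.
  rewrite mulmx_horner_coord ?size_poly // => /(congr1 (mulmx^~ (invmx P))).
  rewrite mulmxK // mul0mx => c0.
  suff r0 : rVpoly c = 0 by rewrite -[c]rVpolyK r0 linear0.
  (* A dependency is a polynomial of degree less than [s] vanishing at the [s] elements of [S]. *)
  apply: (roots_geq_poly_eq0 _ uS); last exact: size_poly.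
  apply/allP => z /memS[j [<- nz]]; rewrite /root -(mulrI_eq0 _ (mulfI nz)).
  by apply/eqP; move/rowP/(_ j): c0; rewrite !mxE.
pose p := \prod_(z <- S) ('X - z%:P).
have sp : size p = s.+1 by rewrite size_prod_XsubC.
have := mulmx_horner_coord (leqnn (size p)).
rewrite sp big_ord_recr /= (_ : p`_s = 1); last first.
  by have /monicP := monic_prod_XsubC S xpredT id; rewrite /lead_coef sp.
rewrite scale1r (_ : (\row_j _) = 0) ?mul0mx; last first.
  apply/rowP => j; rewrite [LHS]mxE [RHS]mxE.
  have [-> | nz] := eqVneq (v 0 j) 0; first by rewrite mul0r.
  suff /eqP -> : root p (d 0 j) by rewrite mulr0.
  by rewrite root_prod_XsubC; apply/memS; exists j.
(* [rel] says that u p(B) = 0; as [p] is monic, it expresses u B^s through the rows of [K]. *)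
move=> rel.
have [] := @submx_map_coef _ _ K (u *m B ^+ s) (- \row_k p`_k) Kfree.
  rewrite mulNmx mapK; under eq_bigr do rewrite mxE.
  by rewrite map_mxM map_mx_expr; apply/eqP; rewrite eqr_oppLR -addr_eq0 rel.
move=> c' cE; have s_gt0 : (s.-1 < s)%N by rewrite prednK // lt0n.
exists (c' 0 (Ordinal s_gt0)).
(* By Vieta, the coefficient of [p] at [s.-1] is minus the sum of the roots. *)
have /rowP /(_ (Ordinal s_gt0)) := cE; rewrite !mxE /= => <-.
by rewrite coefPn_prod_XsubC // opprK.
Qed.

End RationalCyclicVector.

(** * Integrality of the support and the gcd *)

(** The characteristic polynomial is monic and integral, so [q], viewed in [algC], is an algebraic
    integer, and a rational algebraic integer is an integer. *)
Lemma rat_eigenvalue_int (F : numFieldType) n (B : 'M[int]_n) (q : rat) :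
  eigenvalue (map_mx intr B : 'M[F]_n) (ratr q) -> exists z : int, q = z%:~R.
Proof.
have mapB (K : numFieldType) :
    map_mx intr B = map_mx ratr (map_mx intr B) :> 'M[K]_n.
  by apply/matrixP => i j; rewrite !mxE ratr_int.
rewrite mapB eigenvalue_map eigenvalue_root_char => rt.
have : (ratr q : algC) \in Aint.
  apply: (@root_monic_Aint (char_poly (map_mx intr B))).
  - by rewrite mapB -map_char_poly fmorph_root.
  - exact: char_poly_monic.
  - rewrite -map_char_poly; apply/polyOverP => k.
    by rewrite coef_map /= intr_int.
move/(Cint_rat_Aint (Crat_rat q))/intrP => [z qz]; exists z.
by apply: (fmorph_inj (ratr : {rmorphism rat -> algC})); rewrite /= qz ratr_int.
Qed.

Section IntegralSupport.
Variables (R : realType) (n : nat) (adj : rel 'I_n).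
Hypothesis adj_sym : symmetric adj.
Variable a : 'I_n.

Definition int_laplacian : 'M[int]_n :=
  \matrix_(i, j) (#|[set k | adj i k]%SET|%:Z *+ (i == j) - (adj i j)%:Z).

Lemma map_int_laplacian : map_mx intr int_laplacian = laplacian R adj.
Proof.
by apply/matrixP => i j; rewrite !mxE rmorphB rmorphMn /= -!pmulrn.
Qed.

Lemma periodic_at_rational (tau : R) (mu : R[i]) :
  0 < tau -> periodic_at adj a tau -> eigenvalue_support adj a mu ->
  exists q : rat, mu = ratr q.
Proof.
move=> tau_gt0 /(periodic_atP adj_sym) per mu_supp.
have [-> | mu_neq0] := eqVneq mu 0; first by exists 0; rewrite rmorph0.
pose theta : R[i] := (2 * pi / tau)%:C%C.
have multE nu : eigenvalue_support adj a nu ->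
    exists m : nat, nu = m%:R * theta.
  move=> nu_supp; have [k nuk] := per nu nu_supp.
  have := eigenvalue_support_ge0 adj_sym nu_supp.
  move: nuk; case: nu {nu_supp} => x y.
  rewrite lecE /= => tx /andP[/eqP -> x_ge0].
  have pi2_gt0 : 0 < 2 * pi :> R by rewrite mulr_gt0 ?pi_gt0.
  have k_ge0 : 0 <= k.
    by rewrite -(ler0z R) -(pmulr_lge0 _ pi2_gt0) -tx mulr_ge0 // ltW.
  exists `|k|%N; rewrite /theta -(rmorph_nat (real_complex R)) -rmorphM.
  rewrite natr_absz ger0_norm //.
  by congr (_%:C)%C; rewrite mulrA -tx mulrAC divff ?mul1r // gt_eqF.
pose L := laplacian R adj.
have L_normal : L \is normalmx := laplacian_normal R adj_sym.
pose v := unit_vec R a *m invmx (spectralmx L).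
pose S := undup [seq spectral_diag L 0 j | j <- enum 'I_n & v 0 j != 0].
have memS z : z \in S <-> exists j, spectral_diag L 0 j = z /\ v 0 j != 0.
  rewrite mem_undup; split=> [/mapP[j]|[j [<- nz]]].
    by rewrite mem_filter => /andP[nz _] ->; exists j.
  by apply: map_f; rewrite mem_filter nz mem_enum.
have suppS z : z \in S <-> eigenvalue_support adj a z.
  by rewrite memS; symmetry; exact: eigenvalue_supportP.
have [q sumq] : exists q : rat, \sum_(z <- S) z = ratr q.
  apply: (sum_cyclic_support (B := map_mx intr int_laplacian)
    (u := delta_mx 0 a) (d := spectral_diag L)
    (spectral_unit L) _ (undup_uniq _)).
    rewrite -(orthomx_spectralP L_normal) -map_mx_comp /L -map_int_laplacian.
    by apply: eq_map_mx => z /=; rewrite ratr_int.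
  by rewrite map_delta_mx.
have [m summ] : exists m : nat, \sum_(z <- S) z = m%:R * theta.
  rewrite big_seq; elim/big_rec: _ => [|z x /suppS/multE[k ->] [l ->]].
    by exists 0%N; rewrite mul0r.
  by exists (k + l)%N; rewrite natrD mulrDl.
(* The sum is positive: its terms are nonnegative and [mu] is a positive one. *)
have m_neq0 : m%:R != 0 :> R[i].
  suff : 0 < \sum_(z <- S) z.
    by rewrite summ; apply: contraTN => /eqP ->; rewrite mul0r ltxx.
  have muS : mu \in S by apply/suppS.
  have supp_ge0 z : eigenvalue_support adj a z -> 0 <= z.
    exact: eigenvalue_support_ge0.
  have mu_gt0 : 0 < mu by rewrite lt_def mu_neq0 supp_ge0.
  rewrite (big_rem mu) //= ltr_pwDl //.
  by rewrite big_seq sumr_ge0 // => z /mem_rem/suppS /supp_ge0.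
(* From q = m theta, theta is q / m. *)
have [k ->] := multE mu mu_supp; exists (k%:R * (q / m%:R)).
rewrite !rmorphM fmorphV !rmorph_nat /= -sumq summ.
by rewrite mulrAC divff // mul1r.
Qed.

Lemma rational_support_int (mu : R[i]) :
  eigenvalue_support adj a mu -> (exists q : rat, mu = ratr q) ->
  exists z : int, mu = z%:~R.
Proof.
move=> [mu_eig _] [q muq]; move: mu_eig.
rewrite muq -map_int_laplacian => /rat_eigenvalue_int[z ->].
by exists z; rewrite ratr_int.
Qed.

Lemma Re_intc (z : int) : complex.Re (z%:~R : R[i]) = z%:~R.
Proof. by rewrite -(rmorph_int (real_complex R)). Qed.

(** The integers [z] with tau z in 2 pi Z are closed under integer combinations, hence under gcd.
    The product form avoids dividing by a gcd that may be 0. *)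
Lemma periodic_at_support_gcd (tau : R) : periodic_at adj a tau ->
  exists k : int, tau * (support_gcd R adj a)%:R = k%:~R * (2 * pi).
Proof.
move=> /(periodic_atP adj_sym) per; rewrite /support_gcd.
set D := [set z : int | _].
(* An iterated operation over a set takes the neutral value, here 0, when infinitely many terms are
   non-neutral. *)
have [finD | infD] := pselect (finite_set (D `&` absz @^-1` [set~ 0%N]));
  last first.
  by exists 0; rewrite no_finite_support // big_nil mulr0 mul0r.
rewrite big_seq; elim/big_ind: _ => [|x y [k xk] [l yl]|z].
- by exists 0; rewrite mulr0 mul0r.
- have [u [w uw]] := Bezoutz x y; exists (u * k + w * l).
  have -> : (gcdn x y)%:R = (gcdz x y)%:~R :> R by [].
  rewrite -uw !rmorphD !rmorphM /= mulrDr mulrDl -!mulrA -xk -yl.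
  by congr (_ + _); rewrite -pmulrn mulrCA.
- rewrite in_finite_support // inE => -[/= /per[k zk] _].
  (* The sign accounts for the absolute value in the gcd. *)
  exists (sgz z * k); rewrite Re_intc in zk.
  by rewrite rmorphM /= -mulrA -zk pmulrn abszEsg rmorphM /= mulrCA.
Qed.

End IntegralSupport.

Theorem theorem8p3 (R : realType) (n : nat) (adj : rel 'I_n)
    (adj_sym : symmetric adj) (adj_irr : irreflexive adj) (a : 'I_n) :
  ((exists tau : R, 0 < tau /\ periodic_at adj a tau) <->
   (forall mu : R[i], eigenvalue_support adj a mu ->
      exists z : int, mu = z%:~R)) /\
  (forall tau : R, periodic_at adj a tau ->
     support_gcd R adj a <> 0%N ->
     exists k : int, tau = k%:~R * (2 * pi / (support_gcd R adj a)%:R)).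
Proof.
split; first split=> [[tau [tau_gt0 per]] mu mu_supp | supp_int].
- apply: (rational_support_int mu_supp).
  exact: periodic_at_rational tau_gt0 per mu_supp.
- exists (2 * pi); split; first by rewrite mulr_gt0 ?pi_gt0.
  apply/(periodic_atP adj_sym) => mu /supp_int[z ->]; exists z.
  by rewrite Re_intc mulrC.
- move=> tau /(periodic_at_support_gcd adj_sym)[k tauG] /eqP G0; exists k.
  by rewrite mulrA -tauG mulfK // pnatr_eq0.
Qed.
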